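(* Let $r\ge1$ and let $\tau,\tau'$ be permutations of $F^r$ fixing $\mathbf 0$. For a permutation $\pi$ of the $2^{r+1}$ coordinate positions of $F^{2^{r+1}}$, we have $SQS_\tau\sim_\pi SQS_{\tau'}$ if and only if $\pi(S_\tau)=S_{\tau'}$.
   Context: $F=\mathrm{GF}(2)$, $\mathbf 0$ is the all-zero vector. Index the coordinates of $F^{2^r}$ by the vectors of $F^r$; $e_a$ is the unit vector with a single $1$ at position $a$. The extended Hamming code is $\mathcal H=\{x\in F^{2^r}:\sum_{a:x_a=1}a=\mathbf 0,\ \mathrm{wt}(x)\text{ even}\}$. For $x,y\in F^{2^r}$, $x|y\in F^{2^{r+1}}$ is the concatenation and $C\times D=\{x|y:x\in C,y\in D\}$. Define $S_\tau=\bigcup_{a\in F^r}(\mathcal H+e_a+e_{\mathbf 0})\times(\mathcal H+e_{\tau(a)}+e_{\tau(\mathbf 0)})$, an extended perfect code of length $2^{r+1}$ containing the zero vector. The coordinate positions of $F^{2^{r+1}}$ are denoted $(\{a\},\emptyset)$ (position $a$ in the first half) and $(\emptyset,\{a\})$ (position $a$ in the second half), and the support of $x|y$ is written $(\mathrm{supp}(x),\mathrm{supp}(y))$. $SQS_\tau$ is the Steiner quadruple system on these positions consisting of $Q_0=\{(\{a,b,c,d\},\emptyset): a,b,c,d \text{ pairwise distinct}, a+b+c+d=\mathbf 0\}$, $Q_1=\{(\emptyset,\{a,b,c,d\}): a,b,c,d \text{ pairwise distinct}, a+b+c+d=\mathbf 0\}$ and $Q_\tau=\{(\{a,c\},\{b,d\}):\tau(a+c)=b+d\neq\mathbf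 0\}$ (these are the supports of the weight-4 codewords of $S_\tau$). Permutations act on vectors by $\pi(y)_i=y_{\pi^{-1}(i)}$. $SQS_\tau\sim_\pi SQS_{\tau'}$ means $\pi$ maps the set of quadruples of $SQS_\tau$ onto that of $SQS_{\tau'}$. *)

(* Defs.v *)
From HB Require Import structures.
From mathcomp Require Import all_boot all_order all_fingroup all_algebra.
Set Implicit Arguments. Unset Strict Implicit. Unset Printing Implicit Defensive.
Import GRing.Theory.
Local Open Scope ring_scope.

Notation V r := (matrix ('F_2) 1 r).
Notation vec r := {ffun V r -> 'F_2}.
(* coordinate positions of F^{2^{r+1}}: inl a = ({a},∅), inr a = (∅,{a}) *)
Notation pos r := (V r + V r)%type.
Notation vec2 r := {ffun pos r -> 'F_2}.

Definition unitv (r : nat) (a : V r) : vec r := [ffun b => (b == a)%:R].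

Definition wt (r : nat) (x : vec r) : nat := #|[set a | x a != 0]|.

Definition Hcode (r : nat) : {set vec r} :=
  [set x : vec r | (\sum_(a | x a != 0) (a : V r) == 0) && ~~ odd (wt x)].

Definition coset (r : nat) (C : {set vec r}) (v : vec r) : {set vec r} :=
  [set h + v | h : vec r in C].

Definition concat (r : nat) (x y : vec r) : vec2 r :=
  [ffun p : pos r => match p with inl a => x a | inr b => y b end].

Definition Stau (r : nat) (tau : {perm V r}) : {set vec2 r} :=
  [set z : vec2 r | [exists a : V r, exists x : vec r, exists y : vec r,
     [&& x \in coset (Hcode r) (unitv a + unitv 0),
         y \in coset (Hcode r) (unitv (tau a) + unitv (tau 0)) &
         z == concat x y]]].

Definition Q0 (r : nat) : {set {set pos r}} :=
  [set Q : {set pos r} | [exists a : V r, exists b : V r, exists c : V r, exists d : V r,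
     [&& uniq [:: a; b; c; d], a + b + c + d == 0 &
         Q == [set inl a; inl b; inl c; inl d]]]].

Definition Q1 (r : nat) : {set {set pos r}} :=
  [set Q : {set pos r} | [exists a : V r, exists b : V r, exists c : V r, exists d : V r,
     [&& uniq [:: a; b; c; d], a + b + c + d == 0 &
         Q == [set inr a; inr b; inr c; inr d]]]].

Definition Qtau (r : nat) (tau : {perm V r}) : {set {set pos r}} :=
  [set Q : {set pos r} | [exists a : V r, exists b : V r, exists c : V r, exists d : V r,
     [&& tau (a + c) == b + d, b + d != 0 &
         Q == [set inl a; inl c; inr b; inr d]]]].

Definition SQS (r : nat) (tau : {perm V r}) : {set {set pos r}} :=
  Q0 r :|: Q1 r :|: Qtau tau.

Definition permv (r : nat) (pi : {perm pos r}) (y : vec2 r) : vec2 r :=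
  [ffun i => y ((pi^-1)%g i)].

Definition sqs_equiv (r : nat) (pi : {perm pos r}) (tau tau' : {perm V r}) : Prop :=
  [set (pi : pos r -> pos r) @: Q | Q : {set pos r} in SQS tau] = SQS tau'.

(* Main.v *)
(* S_tau consists of the z whose two halves have even weight and coordinate sums u, u'
   with tau u = u', and SQS_tau is the set of supports of its words of weight 4.  Call a
   word h of weight 4 neutral if q + h is in S_tau for all q in S_tau such that q and
   q + h have weight 4; this notion only depends on SQS_tau.  Testing it on the
   quadruples meeting h in one position of each half shows that a neutral h satisfies
   tau (u + v) = tau u + tau v for all u, where v is the sum of its left half, so that
   S_tau + h = S_tau.  The quadruples inside one half are neutral, and adding them
   reduces every word of S_tau to weight 0 or 4.  So S_tau is recovered from SQS_tau in
   a way that commutes with permutations of the positions. *)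
Require Import Defs.
From mathcomp Require Import all_boot all_order all_fingroup all_algebra.
From mathcomp Require Import zify.
Local Open Scope ring_scope.
Set Implicit Arguments. Unset Strict Implicit. Unset Printing Implicit Defensive.
Import GRing.Theory.

(** * Arithmetic in characteristic 2 *)

Lemma F2_neq0 (k : 'F_2) : (k != 0) = (k == 1).
Proof. by case: k => [[|[|n]] Hn]. Qed.

Lemma F2_addxx (k : 'F_2) : k + k = 0.
Proof. by apply/eqP; case: k => [[|[|n]] Hn]. Qed.

Lemma F2_natr_odd (n : nat) : (n%:R == 0 :> 'F_2) = ~~ odd n.
Proof. by rewrite -dvdn2 (dvdn_pcharf (pchar_Fp (isT : prime 2))). Qed.

Lemma F2_natr_neq0 (b : bool) : (b%:R != 0 :> 'F_2) = b.
Proof. by case: b. Qed.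

Lemma rV_addxx (r : nat) (v : V r) : v + v = 0.
Proof. by apply/matrixP => i j; rewrite !mxE F2_addxx. Qed.

Lemma rV_addKK (r : nat) (v w : V r) : v + (v + w) = w.
Proof. by rewrite addrA rV_addxx add0r. Qed.

Lemma rV_add_eq0 (r : nat) (v w : V r) : (v + w == 0) = (v == w).
Proof. by rewrite -(inj_eq (addrI v)) rV_addKK addr0 eq_sym. Qed.

Lemma rV_eq_addl (r : nat) (v w : V r) : (v == v + w) = (w == 0).
Proof. by rewrite -{1}(addr0 v) (inj_eq (addrI v)) eq_sym. Qed.

Lemma ffun_addxx (T : finType) (x : {ffun T -> 'F_2}) : x + x = 0.
Proof. by apply/ffunP => i; rewrite !ffunE F2_addxx. Qed.

(** Turns both sides of the final equivalence into pointwise statements; it serves once for words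
    and once for sets of positions. *)
Lemma imset_eqP (T U : finType) (f : T -> U) (g : U -> T) (A : {set T}) (B : {set U}) :
  cancel f g -> cancel g f -> f @: A = B <-> (forall x, (f x \in B) = (x \in A)).
Proof.
move=> fK gK; split=> [<- x|AB]; first by rewrite mem_imset //; exact: can_inj fK.
by apply/setP => y; rewrite -(gK y) AB mem_imset //; exact: can_inj fK.
Qed.

(** * Binary words and their supports *)

Section Support.
Variable T : finType.
Implicit Types (x y : {ffun T -> 'F_2}) (A : {set T}) (p : T).

Definition supp x : {set T} := [set p | x p != 0].
Definition ind A : {ffun T -> 'F_2} := [ffun p => (p \in A)%:R].

Lemma ind_supp x : ind (supp x) = x.
Proof.
by apply/ffunP => p; rewrite ffunE inE F2_neq0; case: (x p) => [[|[|n]] Hn] //;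
  apply/val_inj.
Qed.

Lemma supp_ind A : supp (ind A) = A.
Proof. by apply/setP => p; rewrite inE ffunE F2_natr_neq0. Qed.

Lemma supp_eq0 x : (#|supp x| == 0)%N = (x == 0).
Proof.
rewrite cards_eq0; apply/eqP/eqP => [x0|->].
  by rewrite -(ind_supp x) x0; apply/ffunP => p; rewrite !ffunE inE.
by apply/setP => p; rewrite !inE ffunE eqxx.
Qed.

Lemma supp_add x y :
  supp (x + y) = (supp x :\: supp y) :|: (supp y :\: supp x).
Proof.
apply/setP => p; rewrite !inE ffunE.
by case: (x p) (y p) => [[|[|n]] Hn] [[|[|m]] Hm].
Qed.

(** Common positions cancel in characteristic 2. The additive form avoids truncated subtraction. *)
Lemma card_supp_add x y :
  (#|supp (x + y)%R| + #|supp x :&: supp y|.*2 = #|supp x| + #|supp y|)%N.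
Proof.
rewrite supp_add cardsU disjoint_setI0 ?cards0.
  have := cardsID (supp y) (supp x); have := cardsID (supp x) (supp y).
  rewrite (setIC (supp y)); lia.
rewrite -setI_eq0; apply/eqP/setP => p; rewrite !inE.
by case: (x p == 0); case: (y p == 0).
Qed.

Lemma ind_uniq4 p1 p2 p3 p4 : uniq [:: p1; p2; p3; p4] ->
  ind [set p1; p2; p3; p4] = ind [set p1] + ind [set p2] + ind [set p3] + ind [set p4].
Proof.
rewrite /= !inE !negb_or => /and4P[/and3P[n12 n13 n14] /andP[n23 n24] n34 _].
apply/ffunP => p; rewrite !ffunE !inE.
have [->|_] := eqVneq p p1; first by rewrite (negPf n12) (negPf n13) (negPf n14) !addr0.
have [->|_] := eqVneq p p2; first by rewrite (negPf n23) (negPf n24) !addr0 add0r.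
have [->|_] := eqVneq p p3; first by rewrite (negPf n34) !addr0 !add0r.
by rewrite !add0r.
Qed.

Lemma cards_uniq4 p1 p2 p3 p4 :
  (#|[set p1; p2; p3; p4]| == 4)%N = uniq [:: p1; p2; p3; p4].
Proof.
have ->: [set p1; p2; p3; p4] = [set p in [:: p1; p2; p3; p4]].
  by apply/setP => p; rewrite !inE -!orbA.
rewrite cardsE; apply/eqP/idP => [c4|/card_uniqP ->//].
by apply/card_uniqP; rewrite c4.
Qed.

Lemma set_card_seq A : exists2 s, uniq s /\ size s = #|A| & A = [set p in s].
Proof.
by exists (enum A); rewrite ?enum_uniq -?cardE //; apply/setP => p; rewrite inE mem_enum.
Qed.

End Support.

(** * Parity and coordinate sum of each half of a word *)

Section Halves.
Variable r : nat.
Implicit Types (x y : vec r) (z h q : vec2 r) (a b c d u v : V r).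

(** [par] and [ssum] together form the syndrome of the extended Hamming code. Summing over all
    positions with the entries as weights makes both additive at once. *)
Definition par x : 'F_2 := \sum_a x a.
Definition ssum x : V r := \sum_a x a *: a.
Definition lft z : vec r := [ffun a => z (inl a)].
Definition rgt z : vec r := [ffun a => z (inr a)].

Lemma parD x y : par (x + y) = par x + par y.
Proof. by rewrite -big_split; apply: eq_bigr => a _; rewrite ffunE. Qed.

Lemma ssumD x y : ssum (x + y) = ssum x + ssum y.
Proof. by rewrite -big_split; apply: eq_bigr => a _; rewrite ffunE scalerDl. Qed.

Lemma lftD z h : lft (z + h) = lft z + lft h.
Proof. by apply/ffunP => a; rewrite !ffunE. Qed.

Lemma rgtD z h : rgt (z + h) = rgt z + rgt h.
Proof. by apply/ffunP => a; rewrite !ffunE. Qed.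

Lemma lft_concat x y : lft (concat x y) = x.
Proof. by apply/ffunP => a; rewrite !ffunE. Qed.

Lemma rgt_concat x y : rgt (concat x y) = y.
Proof. by apply/ffunP => a; rewrite !ffunE. Qed.

Lemma par_supp x : par x = #|supp x|%:R.
Proof.
rewrite -{1}(ind_supp x) -sum1_card natr_sum big_mkcond /=.
by apply: eq_bigr => a _; rewrite ffunE; case: (a \in _).
Qed.

Lemma par_eq0 x : (par x == 0) = ~~ odd #|supp x|.
Proof. by rewrite par_supp F2_natr_odd. Qed.

Lemma ssum_supp x : ssum x = \sum_(a in supp x) a.
Proof.
rewrite -{1}(ind_supp x) [RHS]big_mkcond /=.
by apply: eq_bigr => a _; rewrite ffunE; case: (a \in _); rewrite ?scale1r ?scale0r.
Qed.

Lemma unitv_ind a : unitv a = ind [set a].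
Proof. by apply/ffunP => b; rewrite !ffunE inE. Qed.

Lemma par_unitv a : par (unitv a) = 1.
Proof. by rewrite par_supp unitv_ind supp_ind cards1. Qed.

Lemma ssum_unitv a : ssum (unitv a) = a.
Proof. by rewrite ssum_supp unitv_ind supp_ind big_set1. Qed.

Lemma mem_Hcode x : (x \in Hcode r) = (par x == 0) && (ssum x == 0).
Proof.
rewrite inE andbC par_eq0 ssum_supp; congr (_ && (_ == 0)).
by apply: eq_bigl => a; rewrite inE.
Qed.

(** A coset of a linear code is a fibre of its syndrome, and [unitv a + unitv b] has even weight and
    sum [a + b]. *)
Lemma mem_coset_Hcode x a b :
  (x \in Defs.coset (Hcode r) (unitv a + unitv b)) = (par x == 0) && (ssum x == a + b).
Proof.
apply/imsetP/andP => [[h]|[/eqP px /eqP sx]].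
  rewrite mem_Hcode => /andP[/eqP ph /eqP sh] ->.
  by rewrite !parD !ssumD !par_unitv !ssum_unitv ph sh F2_addxx !add0r !eqxx.
exists (x + (unitv a + unitv b)); last by rewrite -addrA ffun_addxx addr0.
by rewrite mem_Hcode !parD !ssumD !par_unitv !ssum_unitv px sx F2_addxx rV_addxx add0r !eqxx.
Qed.

(** Since [tau] fixes 0, the index of the union can only be the coordinate sum of the left half. *)
Lemma mem_Stau (tau : {perm V r}) z : tau 0 = 0 ->
  (z \in Stau tau) =
    [&& par (lft z) == 0, par (rgt z) == 0 & tau (ssum (lft z)) == ssum (rgt z)].
Proof.
move=> h0; rewrite inE; apply/existsP/and3P => [[a]|[pl pr st]].
  case/existsP=> x /existsP[y /and3P[]]; rewrite !mem_coset_Hcode h0 !addr0.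
  move=> /andP[px /eqP sx] /andP[py /eqP sy] /eqP->.
  by rewrite lft_concat rgt_concat px py sx sy.
exists (ssum (lft z)); apply/existsP; exists (lft z); apply/existsP; exists (rgt z).
rewrite !mem_coset_Hcode h0 !addr0 pl pr eq_sym st eqxx /=.
by apply/eqP/ffunP => -[i|i]; rewrite !ffunE.
Qed.

Lemma supp_lft z : supp (lft z) = inl @^-1: supp z.
Proof. by apply/setP => a; rewrite !inE ffunE. Qed.

Lemma supp_rgt z : supp (rgt z) = inr @^-1: supp z.
Proof. by apply/setP => a; rewrite !inE ffunE. Qed.

Lemma supp_halves z : supp z = inl @: supp (lft z) :|: inr @: supp (rgt z).
Proof.
rewrite supp_lft supp_rgt; apply/setP => -[a|a]; rewrite in_setU.
  rewrite mem_imset ?inE; last by move=> ? ? [].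
  by case: imsetP => [[]//|]; rewrite orbF.
rewrite orbC mem_imset ?inE; last by move=> ? ? [].
by case: imsetP => [[]//|]; rewrite orbF.
Qed.

Lemma card_supp_halves z : #|supp z| = (#|supp (lft z)| + #|supp (rgt z)|)%N.
Proof.
rewrite supp_halves cardsU disjoint_setI0; last first.
  by rewrite disjoints_subset; apply/subsetP => p /imsetP[a _ ->];
    rewrite inE; apply/imsetP => -[].
by rewrite cards0 subn0 !card_imset // => ? ? [].
Qed.

End Halves.

(** * Quadruples, neutral words and weight reduction in the code *)

Section Code.
Variables (r : nat) (tau : {perm V r}).
Hypothesis tau0 : tau 0 = 0.
Implicit Types (z h q : vec2 r) (a b c d u v : V r).

Lemma lft_inl a : lft (ind [set inl a]) = unitv a.
Proof. by apply/ffunP => i; rewrite !ffunE inE. Qed.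

Lemma lft_inr a : lft (ind [set inr a]) = 0.
Proof. by apply/ffunP => i; rewrite !ffunE inE. Qed.

Lemma rgt_inl a : rgt (ind [set inl a]) = 0.
Proof. by apply/ffunP => i; rewrite !ffunE inE. Qed.

Lemma rgt_inr a : rgt (ind [set inr a]) = unitv a.
Proof. by apply/ffunP => i; rewrite !ffunE inE. Qed.

Lemma lft0 : lft (0 : vec2 r) = 0.
Proof. by apply/ffunP => a; rewrite !ffunE. Qed.

Lemma rgt0 : rgt (0 : vec2 r) = 0.
Proof. by apply/ffunP => a; rewrite !ffunE. Qed.

Lemma par0 : par (0 : vec r) = 0.
Proof. by apply: big1 => a _; rewrite ffunE. Qed.

Lemma ssum0 : ssum (0 : vec r) = 0.
Proof. by apply: big1 => a _; rewrite ffunE scale0r. Qed.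

Definition halvesE :=
  (lftD, rgtD, lft_inl, lft_inr, rgt_inl, rgt_inr, parD, ssumD, par_unitv, ssum_unitv,
   lft0, rgt0, par0, ssum0).

Lemma ssum_set (s : seq (V r)) : uniq s -> ssum (ind [set a in s]) = \sum_(a <- s) a.
Proof.
move=> us; rewrite ssum_supp supp_ind big_uniq //=.
by apply: eq_bigl => a; rewrite inE.
Qed.

Lemma mem_SQS z : (supp z \in SQS tau) = (z \in Stau tau) && (#|supp z| == 4)%N.
Proof.
rewrite mem_Stau //; apply/idP/andP => [|[/and3P[pl pr /eqP st] /eqP c4]].
  have quadE p1 p2 p3 p4 : supp z = [set p1; p2; p3; p4] -> uniq [:: p1; p2; p3; p4] ->
      (#|supp z| == 4)%N /\
      z = ind [set p1] + ind [set p2] + ind [set p3] + ind [set p4].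
    by move=> sz u4; rewrite -ind_uniq4 // -sz ind_supp sz cards_uniq4.
  rewrite 2!in_setU -orbA => /or3P[]; rewrite
    in_set => /existsP[a /existsP[b /existsP[c /existsP[d]]]].
  - case/and3P=> u4 /eqP s0 /eqP/quadE[];
      first by rewrite -(map_inj_uniq (@inl_inj (V r) (V r))) in u4.
    by move=> -> ->; rewrite !halvesE s0 !addr0 tau0 !eqxx.
  - case/and3P=> u4 /eqP s0 /eqP/quadE[];
      first by rewrite -(map_inj_uniq (@inr_inj (V r) (V r))) in u4.
    by move=> -> ->; rewrite !halvesE s0 !add0r tau0 !eqxx.
  case/and3P=> /eqP tac nbd /eqP/quadE[].
    rewrite /= !inE !negb_or /= !andbT; apply/andP; split; apply: contra nbd => /eqP[].
      by move=> ac; rewrite -tac ac rV_addxx tau0.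
    by move=> ->; rewrite rV_addxx.
  by move=> -> ->; rewrite !halvesE !addr0 !add0r tac !eqxx.
have [sl [ul szl] El] := set_card_seq (supp (lft z)).
have [sr [ur szr] Er] := set_card_seq (supp (rgt z)).
rewrite -(ind_supp (lft z)) -(ind_supp (rgt z)) El Er !ssum_set // in st.
move: c4 pl pr; rewrite card_supp_halves !par_eq0 -szl -szr => c4 evl evr.
have Ez := supp_halves z; rewrite {}El {}Er in Ez; rewrite {}Ez.
have imE (T U : finType) (f : T -> U) (s : seq T) : f @: [set p in s] = [set p in map f s].
  by apply/setP => p; rewrite inE; apply/imsetP/mapP => -[x]; rewrite ?inE => xs ->;
    exists x; rewrite ?inE.
rewrite !imE 2!in_setU; move: sl sr c4 evl evr ul ur st {szl szr}.
(* The two lengths are even and add up to 4, so only (0,4), (2,2) and (4,0) survive; in this order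
   they yield [Q1], [Qtau] and [Q0]. *)
move=> [|a [|b [|c [|d [|e sl]]]]] [|a' [|b' [|c' [|d' [|e' sr]]]]] //= _ _ _ ul ur;
  rewrite !big_cons !big_nil ?addr0 ?add0r.
- move=> s0; apply/orP; left; apply/orP; right.
  rewrite in_set; apply/existsP; exists a'; apply/existsP; exists b'.
  apply/existsP; exists c'; apply/existsP; exists d'.
  rewrite /= ur -!addrA -s0 tau0 eqxx /=.
  by apply/eqP/setP => p; rewrite !inE -!orbA.
- move=> s0; apply/orP; right.
  rewrite in_set; apply/existsP; exists a; apply/existsP; exists a'.
  apply/existsP; exists b; apply/existsP; exists b'.
  rewrite s0 eqxx rV_add_eq0; move: ur; rewrite inE => /andP[-> _] /=.
  by apply/eqP/setP => p; rewrite !inE -!orbA.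
move=> s0; apply/orP; left; apply/orP; left.
rewrite in_set; apply/existsP; exists a; apply/existsP; exists b.
apply/existsP; exists c; apply/existsP; exists d.
rewrite /= ul -!addrA -(inj_eq (@perm_inj _ tau)) s0 tau0 eqxx /=.
by apply/eqP/setP => p; rewrite !inE -!orbA orbF.
Qed.

Lemma mem_SQS4 z : #|supp z| = 4%N -> (supp z \in SQS tau) = (z \in Stau tau).
Proof. by move=> z4; rewrite mem_SQS z4; exact: andbT. Qed.

(* [h] is always taken in [S] and of weight 4, so that the two cardinality conditions
   say that the supports of [q] and [h] meet in exactly two positions. *)
Definition neutral (S : {set vec2 r}) h := forall q,
  q \in S -> #|supp q| = 4%N -> #|supp (q + h)| = 4%N -> q + h \in S.

Lemma neutral_additive h u : h \in Stau tau -> #|supp h| = 4%N -> neutral (Stau tau) h ->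
  tau (u + ssum (lft h)) = tau u + tau (ssum (lft h)).
Proof.
move=> hS h4 nh; set v := ssum _.
(* In these three cases the identity is immediate. They are set aside because [h] need not meet both
   halves when [v = 0], while the test word [q] below degenerates when [u = 0], and [q + h] when
   [u = v]. *)
have [v0|v0] := eqVneq v 0; first by rewrite v0 tau0 !addr0.
have [->|u0] := eqVneq u 0; first by rewrite tau0 !add0r.
have [->|uv] := eqVneq u v; first by rewrite !rV_addxx tau0.
have := mem_SQS h; rewrite hS h4 eqxx /= => hQ.
(* Quadruples inside one half have left sum 0, so [v != 0] leaves only the type [Qtau]. *)
have {hQ} [a [c [b [d [tac nbd Eh]]]]] : exists a c b d,
    [/\ tau (a + c) = b + d, b + d != 0 &
      h = ind [set inl a] + ind [set inl c] + ind [set inr b] + ind [set inr d]].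
  have quadE p1 p2 p3 p4 : supp h = [set p1; p2; p3; p4] ->
      h = ind [set p1] + ind [set p2] + ind [set p3] + ind [set p4].
    by move=> sh; rewrite -ind_uniq4 -?cards_uniq4 -sh ?ind_supp ?h4.
  move: hQ v0; rewrite /v 2!in_setU -orbA => /or3P[];
    rewrite in_set => /existsP[a /existsP[b /existsP[c /existsP[d]]]] /and3P[].
  - by move=> _ /eqP s0 /eqP/quadE->; rewrite !halvesE s0 eqxx.
  - by move=> _ _ /eqP/quadE->; rewrite !halvesE !addr0 eqxx.
  by move=> /eqP tac nbd /eqP/quadE Eh _; exists a, c, b, d.
have Ev : v = a + c by rewrite /v Eh !halvesE !addr0.
have tu0 : tau u != 0 by rewrite -tau0 (inj_eq (@perm_inj _ tau)).
have tuv : tau u != tau v by rewrite (inj_eq (@perm_inj _ tau)).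
have aNc w : (a + w == c) = (w == v) by rewrite Ev -(inj_eq (addrI a)) rV_addKK.
have bNd w : (b + w == d) = (w == tau v).
  by rewrite Ev tac -(inj_eq (addrI b)) rV_addKK.
(* [q] shares exactly [inl a] and [inr b] with [h], and its left and right sums are [u] and [tau u];
   hence it lies in the code. *)
pose q : vec2 r := ind [set inl a] + ind [set inl (a + u)] +
  ind [set inr b] + ind [set inr (b + tau u)].
have uniq_lr (x x' y y' : V r) :
    uniq [:: inl x; inl x'; inr y; inr y' : pos r] = (x != x') && (y != y').
  by rewrite /= !inE !negb_or /= !andbT !(inj_eq (@inl_inj _ _)) !(inj_eq (@inr_inj _ _)).
have q4 : #|supp q| = 4%N.
  by apply/eqP; rewrite /q -ind_uniq4 ?supp_ind ?cards_uniq4 uniq_lr !rV_eq_addl u0 tu0.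
have qhE : q + h = ind [set inl (a + u)] + ind [set inl c] +
    ind [set inr (b + tau u)] + ind [set inr d].
  apply/ffunP => p; rewrite /q Eh !ffunE; apply/val_inj.
  by do 6!case: (p \in _).
have qh4 : #|supp (q + h)| = 4%N.
  by apply/eqP; rewrite qhE -ind_uniq4 ?supp_ind ?cards_uniq4 uniq_lr aNc bNd uv tuv.
have qS : q \in Stau tau.
  by rewrite mem_Stau // !halvesE !addr0 !add0r !rV_addKK !eqxx.
have := nh q qS q4 qh4.
rewrite qhE mem_Stau // !halvesE !addr0 !add0r => /and3P[_ _ /eqP].
(* Membership of [q + h] reads [tau (a + u + c) = b + tau u + d], where [a + c = v] and
   [b + d = tau v]. *)
by rewrite Ev tac [u + _]addrCA (addrA a u c) => ->; rewrite [RHS]addrCA addrA.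
Qed.

Lemma neutral_add h z : h \in Stau tau -> #|supp h| = 4%N -> neutral (Stau tau) h ->
  z \in Stau tau -> z + h \in Stau tau.
Proof.
move=> hS h4 nh; have tauD := neutral_additive _ hS h4 nh.
move: hS; rewrite !mem_Stau // !lftD !rgtD !parD !ssumD.
move=> /and3P[/eqP-> /eqP-> /eqP E] /and3P[/eqP-> /eqP-> /eqP<-].
by rewrite !addr0 !eqxx tauD E eqxx.
Qed.

(** Adding such a word changes no parity and no coordinate sum, hence not membership in the code. *)
Lemma zero_sum_neutral h : par (lft h) = 0 -> ssum (lft h) = 0 ->
  par (rgt h) = 0 -> ssum (rgt h) = 0 -> h \in Stau tau /\ neutral (Stau tau) h.
Proof.
move=> pl sl pr sr; rewrite mem_Stau // pl sl pr sr tau0 !eqxx; split=> // q.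
by rewrite !mem_Stau // !lftD !rgtD !parD !ssumD pl sl pr sr !addr0.
Qed.

(** Three support positions [a], [b], [c] are completed by [a + b + c] to a quadruple with sum 0.
    Adding it removes these three and creates at most one, so the weight drops by at least 2. *)
Lemma Hamming_reduce (x : vec r) : (2 < #|supp x|)%N ->
  exists y : vec r, [/\ par y = 0, ssum y = 0, #|supp y| = 4%N & (#|supp (x + y)%R| < #|supp x|)%N].
Proof.
have [[|a [|b [|c s]]] [us <-] Ex] // := set_card_seq (supp x) => _.
have /and4P[ab ac bc _] : [&& a != b, a != c, b != c & true].
  move: us; rewrite /= !inE !negb_or => /and3P[/and3P[-> -> _] /andP[-> _] _]; done.
(* If [a + b + c] were one of the three, the other two would coincide. *)
have u4 : uniq [:: a; b; c; a + b + c].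
  rewrite /= !inE !negb_or ab ac bc /= andbT; apply/and3P; split.
  - by rewrite -addrA rV_eq_addl rV_add_eq0.
  - by rewrite (addrC a) -addrA rV_eq_addl rV_add_eq0.
  by rewrite addrC rV_eq_addl rV_add_eq0.
pose y := ind [set a; b; c; a + b + c].
have y4 : #|supp y| = 4%N by apply/eqP; rewrite supp_ind cards_uniq4.
exists y; split=> //.
- by apply/eqP; rewrite par_eq0 y4.
- by rewrite /y ind_uniq4 // -!unitv_ind !ssumD !ssum_unitv rV_addxx.
have := card_supp_add x y; rewrite y4.
have: (#|[set a; b; c]| <= #|supp x :&: supp y|)%N.
  apply: subset_leq_card; apply/subsetP => p; rewrite supp_ind Ex !inE.
  by case/orP=> [/orP[]|] /eqP->; rewrite !eqxx ?orbT.
have -> : #|[set a; b; c]| = 3%N.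
  by rewrite setUC cardsU1 cards2 ab !inE negb_or eq_sym ac eq_sym bc.
have <- : size [:: a, b, c & s] = #|supp x| by rewrite Ex cardsE; exact/esym/card_uniqP.
move=> /=; lia.
Qed.

Lemma ssum_card2 (x : vec r) : #|supp x| = 2%N -> ssum x != 0.
Proof.
move=> x2; have /cards2P[a [b [ab Ex]]] : (#|supp x| == 2)%N by rewrite x2.
by rewrite ssum_supp Ex big_setU1 ?inE // big_set1 rV_add_eq0.
Qed.

(** A half of weight above 2 is shortened by a quadruple inside that half. Otherwise the even
    weights of the halves are 0 or 2, and the excluded totals 0 and 4 leave only total 2, which no
    codeword has. *)
Lemma Stau_reduce z : z \in Stau tau -> z != 0 -> #|supp z| != 4%N ->
  exists h, [/\ h \in Stau tau, #|supp h| = 4%N, neutral (Stau tau) h &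
    (#|supp (z + h)%R| < #|supp z|)%N].
Proof.
move=> zS z0 z4.
have s0 : #|supp (0 : vec r)| = 0%N by apply/eqP; rewrite supp_eq0.
have [gtl|lel] := ltnP 2 #|supp (lft z)|.
  have [y [py sy y4 lt]] := Hamming_reduce gtl; exists (concat y 0).
  have [] := @zero_sum_neutral (concat y 0); rewrite ?lft_concat ?rgt_concat ?par0 ?ssum0 //.
  move=> hS nh; split=> //; first by rewrite card_supp_halves lft_concat rgt_concat s0 addn0.
  by rewrite !card_supp_halves lftD rgtD lft_concat rgt_concat addr0 ltn_add2r.
have [gtr|ler] := ltnP 2 #|supp (rgt z)|.
  have [y [py sy y4 lt]] := Hamming_reduce gtr; exists (concat 0 y).
  have [] := @zero_sum_neutral (concat 0 y); rewrite ?lft_concat ?rgt_concat ?par0 ?ssum0 //.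
  move=> hS nh; split=> //; first by rewrite card_supp_halves lft_concat rgt_concat s0.
  by rewrite !card_supp_halves lftD rgtD lft_concat rgt_concat addr0 ltn_add2l.
move: zS z0 z4; rewrite mem_Stau // -supp_eq0 card_supp_halves !par_eq0.
move=> /and3P[ol or /eqP E] z0 z4.
(* The half of weight 2 has nonzero sum and the empty half has sum 0, against [E], since [tau] is
   injective and fixes 0. *)
have [[l2 r0]|[l0 r2]] : (#|supp (lft z)| = 2 /\ #|supp (rgt z)| = 0 \/
    #|supp (lft z)| = 0 /\ #|supp (rgt z)| = 2)%N by lia.
  move/ssum_card2/negP: l2; case; rewrite -(inj_eq (@perm_inj _ tau)) E tau0.
  by move/eqP: r0; rewrite supp_eq0 => /eqP->; rewrite ssum0.
move/ssum_card2/negP: r2; case; rewrite -E.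
by move/eqP: l0; rewrite supp_eq0 => /eqP->; rewrite ssum0 tau0.
Qed.

End Code.

(** * Permutations of the positions and transport of the code *)

Section Equivalence.
Variable r : nat.
Implicit Types (pi : {perm pos r}) (z h : vec2 r).

Lemma permvD pi z h : permv pi (z + h) = permv pi z + permv pi h.
Proof. by apply/ffunP => p; rewrite !ffunE. Qed.

Lemma permvK pi : cancel (permv pi) (permv pi^-1).
Proof. by move=> z; apply/ffunP => p; rewrite !ffunE invgK permK. Qed.

Lemma permvKV pi : cancel (permv pi^-1) (permv pi).
Proof. by move=> z; rewrite -{1}(invgK pi) permvK. Qed.

Lemma supp_permv pi z : supp (permv pi z) = pi @: supp z.
Proof.
apply/setP => p; rewrite inE ffunE -{2}(permKV pi p) mem_imset ?inE //.
exact: perm_inj.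
Qed.

Lemma card_supp_permv pi z : #|supp (permv pi z)| = #|supp z|.
Proof. by rewrite supp_permv card_imset //; exact: perm_inj. Qed.

(** Induction on the weight. Only an inclusion is claimed; the converse comes from applying the
    lemma to the inverse permutation. *)
Lemma Stau_permv (tau tau' : {perm V r}) pi : tau 0 = 0 -> tau' 0 = 0 ->
  (forall z, #|supp z| = 4%N -> (permv pi z \in Stau tau') = (z \in Stau tau)) ->
  forall z, z \in Stau tau -> permv pi z \in Stau tau'.
Proof.
move=> t0 t0' H4 z; have [n] := ubnP #|supp z|.
elim: n z => [|n IHn] z; first by rewrite ltn0 => /notF[].
move=> ltz zS.
have [->|z0] := eqVneq z 0.
  have -> : permv pi 0 = 0 by apply/ffunP => p; rewrite !ffunE.
  by rewrite mem_Stau // !halvesE t0' !eqxx.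
have [z4|z4] := eqVneq #|supp z| 4%N; first by rewrite H4.
have [h [hS h4 nh lt]] := Stau_reduce t0 zS z0 z4.
(* The lighter word [z + h] is handled by induction, and the image of [h] is then added back, which
   is allowed once that image is known to be neutral. *)
have -> : z = (z + h) + h by rewrite -addrA ffun_addxx addr0.
have phS : permv pi h \in Stau tau' by rewrite (H4 _ h4).
have ph4 : #|supp (permv pi h)| = 4%N by rewrite card_supp_permv.
(* Neutrality only tests words of weight 4, and on these [H4] identifies the two codes. *)
have phn : neutral (Stau tau') (permv pi h).
  move=> q'; rewrite -(permvKV pi q'); move: (permv pi^-1 q') => q.
  rewrite -permvD !card_supp_permv => qS q4 qh4.
  move: qS; rewrite (H4 _ q4) => qS; rewrite (H4 _ qh4).
  exact: (nh _ qS q4 qh4).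
rewrite permvD; apply: (neutral_add t0' phS ph4 phn).
apply: IHn (neutral_add t0 hS h4 nh zS); exact: leq_trans lt _.
Qed.

End Equivalence.

Theorem theorem2 (r : nat) (hr : (1 <= r)%N) (tau tau' : {perm V r})
  (h0 : tau 0 = 0) (h0' : tau' 0 = 0) (pi : {perm pos r}) :
  sqs_equiv pi tau tau' <-> [set permv pi x | x in Stau tau] = Stau tau'.
Proof.
have imK : cancel (fun Q : {set pos r} => pi @: Q) (fun Q : {set pos r} => (pi^-1)%g @: Q).
  by move=> Q; rewrite -imset_comp (eq_imset _ (permK pi)) imset_id.
have imKV : cancel (fun Q : {set pos r} => (pi^-1)%g @: Q) (fun Q : {set pos r} => pi @: Q).
  by move=> Q; rewrite -imset_comp (eq_imset _ (permKV pi)) imset_id.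
have H := imset_eqP _ _ (permvK pi) (permvKV pi).
rewrite /sqs_equiv (imset_eqP _ _ imK imKV) H {H}; split=> [HQ|HS Q].
  have H4 z : #|supp z| = 4%N -> (permv pi z \in Stau tau') = (z \in Stau tau).
    move=> z4; rewrite -(mem_SQS4 h0' (etrans (card_supp_permv pi z) z4)).
    by rewrite -(mem_SQS4 h0 z4) supp_permv HQ.
  move=> z; apply/idP/idP; last exact: Stau_permv.
  (* The weight-4 hypothesis is symmetric, so the inverse permutation carries the second code back
     into the first. *)
  rewrite -{2}(permvK pi z); apply: Stau_permv h0' h0 _ _ => x x4.
  by rewrite -[in RHS](permvKV pi x) (H4 (permv pi^-1 x)) // card_supp_permv.
(* Every set of positions is the support of its indicator word, and permuting preserves weight 4. *)
by rewrite -(supp_ind Q) -supp_permv (mem_SQS h0') (mem_SQS h0) card_supp_permv HS.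
Qed.
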